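(* Let $\mathcal{T}\subseteq\mathbb{R}^{n_0\times n_1\times\dots\times n_d}$ be an embedded manifold of low-rank tensors, let $$G:\mathcal{T}\to\mathcal{V}^{n_0},\qquad G(\mathsf{A})=\langle\mathsf{A},\Phi(\cdot)\rangle,$$ and let $\mathcal{H}=\operatorname{Im}G\subseteq L_2(\mathcal{X},\mathbb{R}^{n_0};\mu_{\mathcal{X}})$ be equipped with the Riemannian metric $$\langle\zeta,\xi\rangle_f=\int_{\mathcal{X}}\langle\zeta(x),\xi(x)\rangle_{\mathcal{Y}}\,\mu_{\mathcal{X}}(dx),\qquad \zeta,\xi\in T_f\mathcal{H},\ f\in\mathcal{H},$$ where $\langle\cdot,\cdot\rangle_{\mathcal{Y}}$ is an inner product on $\mathcal{Y}=\mathbb{R}^{n_0}$. Then for a tensor $\mathsf{A}\in\mathcal{T}$ it holds that $$DG(\mathsf{A})^*DG(\mathsf{A})=I_{n_0}\otimes\int_{\mathcal{X}}\Phi_1(x_1)\Phi_1(x_1)^{\mathsf T}\otimes\dots\otimes\Phi_d(x_d)\Phi_d(x_d)^{\mathsf T}\,\mu_{\mathcal{X}}(dx),$$ where $\otimes$ denotes the tensor product of linear operators.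
   Context: Let $d,n_0,n_1,\dots,n_d\in\mathbb{N}$, $\Omega_1,\dots,\Omega_d\subseteq\mathbb{R}$, $\mathcal{X}=\Omega_1\times\dots\times\Omega_d\subseteq\mathbb{R}^d$, and let $\mu_{\mathcal{X}}$ be a probability measure on $\mathcal{X}$ (the marginal on $\mathcal{X}$ of a joint probability measure on $\mathcal{X}\times\mathcal{Y}$). For $\nu=1,\dots,d$, $V_\nu$ is an $n_\nu$-dimensional vector space of real-valued continuous functions on $\Omega_\nu$ with basis $\varphi^\nu_1,\dots,\varphi^\nu_{n_\nu}$, and $\Phi_\nu=(\varphi^\nu_1,\dots,\varphi^\nu_{n_\nu})^{\mathsf T}:\Omega_\nu\to\mathbb{R}^{n_\nu}$. Set $\mathcal{V}=V_1\otimes\dots\otimes V_d$ and $\Phi(x)=\Phi_1(x_1)\otimes\dots\otimes\Phi_d(x_d)\in\mathbb{R}^{n_1\times\dots\times n_d}$. The contraction $\langle\mathsf{A},\Phi(x)\rangle\in\mathbb{R}^{n_0}$ along modes $1,\dots,d$ has $k$-th component $\sum_{j_1,\dots,j_d}\mathsf{A}_{k,j_1,\dots,j_d}\varphi^1_{j_1}(x_1)\cdots\varphi^d_{j_d}(x_d)$. An example of $\mathcal{T}$ is the set of tensors of fixed tensor-train rank, i.e. whose matricizations separating modes $0,\dots,k-1$ from modes $k,\dots,d$ have prescribed ranks $r_k$, $k=1,\dots,d$; more generally, $\mathcal{T}$ may be a fixed-rank tree tensor network manifold. $\mathcal{T}$ carries the Riemannian metric inherited from the Euclidean (Frobenius)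 inner product of $\mathbb{R}^{n_0\times\dots\times n_d}$. $T_f\mathcal{H}$ is the tangent space of $\mathcal{H}$ at $f$, $DG(\mathsf{A}):T_{\mathsf{A}}\mathcal{T}\to T_{G(\mathsf{A})}\mathcal{H}$ is the differential of $G$ at $\mathsf{A}$, and $DG(\mathsf{A})^*$ is its adjoint with respect to the Riemannian metrics on $\mathcal{T}$ and $\mathcal{H}$. $I_{n_0}$ is the $n_0\times n_0$ identity. The tensor product of operators is given by $(M_0\otimes\dots\otimes M_d)(b_0\otimes\dots\otimes b_d)=M_0b_0\otimes\dots\otimes M_db_d$.
   Formalization: The identity holds after orthogonal projection of the right side onto the tangent space of T at A, which it need not preserve; the metric on T is induced by the inner product on Y in mode 0 and Euclidean in other modes (Frobenius if Y is Euclidean), as otherwise the identity factor is wrong. *)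

(* Defs.v *)
From HB Require Import structures.
From mathcomp Require Import all_boot all_order all_algebra.
From mathcomp Require Import all_classical all_reals all_analysis.

Set Implicit Arguments.
Unset Strict Implicit.
Unset Printing Implicit Defensive.

Import Order.TTheory GRing.Theory Num.Theory.
Import numFieldNormedType.Exports.

Local Open Scope classical_set_scope.
Local Open Scope ring_scope.

(* Multi-indices (j_1, .., j_d).  A tensor of size n_1 x .. x n_d is stored as
   a column vector indexed by 'I_#|mindex n| through enum_val, and a tensor of
   size n_0 x n_1 x .. x n_d as the matrix separating mode 0 from the others. *)
Definition mindex d (n : 'I_d -> nat) := {dffun forall nu, 'I_(n nu)}.

Definition tensor (R : realType) (n0 : nat) d (n : 'I_d -> nat) :=
  'M[R]_(n0, #|mindex n|).

Section TensorProduct.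
Context {R : realType} {d : nat} {n : 'I_d -> nat}.

Definition mi (i : 'I_#|mindex n|) : mindex n := enum_val i.

(* v_1 (x) .. (x) v_d *)
Definition tens (v : forall nu, 'cV[R]_(n nu)) : 'cV[R]_#|mindex n| :=
  \col_i \prod_(nu < d) v nu (mi i nu) 0.

(* M_1 (x) .. (x) M_d *)
Definition tensop (M : forall nu, 'M[R]_(n nu)) : 'M[R]_#|mindex n| :=
  \matrix_(i, j) \prod_(nu < d) M nu (mi i nu) (mi j nu).

Lemma tensopE (M : forall nu, 'M[R]_(n nu)) (v : forall nu, 'cV[R]_(n nu)) :
  tensop M *m tens v = tens (fun nu => M nu *m v nu).
Proof.
apply/colP => i; rewrite !mxE.
pose F nu : {ffun 'I_(n nu) -> R} := [ffun k => M nu (mi i nu) k * v nu k 0].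
transitivity (\sum_(j : 'I_#|mindex n|) \prod_nu F nu (mi j nu)).
  apply: eq_bigr => j _; rewrite !mxE -big_split.
  by apply: eq_bigr => nu _; rewrite ffunE.
rewrite -(big_enum_val (fun j : mindex n => \prod_nu F nu (j nu))) /=.
rewrite (reindex (@dffun_of_fprod _ _)) /=; last exact/onW_bij/dffun_of_fprod_bij.
transitivity (\sum_(t : fprod (fun nu => 'I_(n nu)))
  \prod_(nu in 'I_d) F nu (t nu)).
  apply: eq_big => // t _; apply: eq_bigr => nu _.
  by rewrite /dffun_of_fprod [X in F nu X]ffunE.
rewrite [LHS](big_fprod _ _ F).
rewrite -(bigA_distr_big_dep _ (fun nu => untag 0 (F nu))).
apply: eq_bigr => nu _; rewrite mxE -(big_tag (fun nu => F nu)).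
by apply: eq_bigr => k _; rewrite ffunE.
Qed.

(* M0 (x) K acting on tensors with n_0 rows: b0 (x) b is b0 *m b^T *)
Definition tensop0 n0 (M0 : 'M[R]_n0) (K : 'M[R]_#|mindex n|)
    (A : tensor R n0 n) : tensor R n0 n :=
  M0 *m A *m K^T.

Lemma tensop0E n0 (M0 : 'M[R]_n0) (K : 'M[R]_#|mindex n|)
    (b0 : 'cV[R]_n0) (b : 'cV[R]_#|mindex n|) :
  tensop0 M0 K (b0 *m b^T) = (M0 *m b0) *m (K *m b)^T.
Proof. by rewrite /tensop0 trmx_mul !mulmxA. Qed.

End TensorProduct.

(* The inner product of Y (x) R^{n_1} (x) .. (x) R^{n_d} induced by that of Y
   and the Euclidean ones; see tensor_dot_frobenius. *)
Definition tensor_dot (R : realType) n0 d (n : 'I_d -> nat)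
    (ipY : 'cV[R]_n0 -> 'cV[R]_n0 -> R) (A B : tensor R n0 n) : R :=
  \sum_j ipY (col j A) (col j B).

Lemma tensor_dot_frobenius (R : realType) n0 d (n : 'I_d -> nat)
    (ipY : 'cV[R]_n0 -> 'cV[R]_n0 -> R) (A B : tensor R n0 n) :
  (forall u v, ipY u v = \sum_k u k 0 * v k 0) ->
  tensor_dot ipY A B = \sum_k \sum_j A k j * B k j.
Proof.
move=> ipYE; rewrite /tensor_dot exchange_big /=; apply: eq_bigr => j _.
by rewrite ipYE; apply: eq_bigr => k _; rewrite !mxE.
Qed.

Section Submanifold.
Context {R : realType}.

Fixpoint Ck (k : nat) (E F : normedModType R) (D : set E) (f : E -> F) : Prop :=
  if k is k'.+1 then
    (forall x, D x -> differentiable f x) /\ (forall v, Ck k' D ('D_v f))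
  else forall x, D x -> {for x, continuous f}.

(* D is meant to be open and E finite-dimensional. *)
Definition smooth_on (E F : normedModType R) (D : set E) (f : E -> F) : Prop :=
  forall k, Ck k D f.

(* Slice charts: around each of its points, S is mapped to R^m x {0} by a
   diffeomorphism h : U -> W (with inverse g) between open sets. *)
Definition embedded_submanifold p q (m : nat) (S : set 'M[R]_(p, q)) : Prop :=
  (m <= p * q)%N /\
  forall A, S A ->
    exists (U : set 'M[R]_(p, q)) (W : set 'rV[R]_(p * q))
           (h : 'M[R]_(p, q) -> 'rV[R]_(p * q))
           (g : 'rV[R]_(p * q) -> 'M[R]_(p, q)),
      [/\ open U, U A, open W, smooth_on U h & smooth_on W g] /\
      [/\ forall B, U B -> W (h B) /\ g (h B) = B,
          forall y, W y -> U (g y) /\ h (g y) = y &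
          forall B, U B ->
            (S B <-> forall i : 'I_(p * q), (m <= i)%N -> h B 0 i = 0)].

Definition curve_in p q (S : set 'M[R]_(p, q)) (A xi : 'M[R]_(p, q))
    (c : R -> 'M[R]_(p, q)) : Prop :=
  [/\ c 0 = A, (\forall t \near (0 : R), S (c t)) & is_derive (0 : R) 1 c xi].

Definition tangent_space p q (S : set 'M[R]_(p, q)) (A : 'M[R]_(p, q)) :
    set 'M[R]_(p, q) :=
  [set xi | exists c, curve_in S A xi c].

End Submanifold.

(* p is the orthogonal projection of v onto S.  An operator K of the ambient
   tensor space need not preserve the tangent space S of a submanifold; as an
   operator on S it is the compression S -> S, xi |-> proj_S (K xi), which
   represents the bilinear form (xi, eta) |-> ip (K xi) eta on S (and is the
   restriction of K when K preserves S). *)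
Definition is_orth_proj (R : realType) (E : lmodType R) (ip : E -> E -> R)
    (S : set E) (v p : E) : Prop :=
  S p /\ forall w, S w -> ip p w = ip v w.

Section Domain.
Context {R : realType} {d : nat}.

Definition domain_set (Omega : 'I_d -> set R) : set (d.-tuple R) :=
  [set x | forall nu, Omega nu (tnth x nu)].

(* The type Omega_1 x .. x Omega_d.  The library's measurable types are
   pointed; providing the point is the only role of x0. *)
Definition domain (Omega : 'I_d -> set R) (x0 : domain_set Omega) : Type :=
  domain_set Omega.

Section Structure.
Variables (Omega : 'I_d -> set R) (x0 : domain_set Omega).

HB.instance Definition _ := Choice.copy (domain x0) (set_type (domain_set Omega)).
HB.instance Definition _ := isPointed.Build (domain x0) x0.

Definition incl (x : domain x0) : d.-tuple (measurableTypeR R) := \val x.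

(* its Borel sets: the traces of the Borel sets of R^d *)
Definition borel_domain := g_sigma_algebra_preimageType incl.
End Structure.

Definition coord (Omega : 'I_d -> set R) (x0 : domain_set Omega)
  (x : borel_domain x0) (nu : 'I_d) : R := tnth (incl (x0 := x0) x) nu.

End Domain.

Section FunctionSpaces.
Context {R : realType} {d : nat} {n : 'I_d -> nat}.
Context {Omega : 'I_d -> set R} {x0 : domain_set Omega}.
Variable phi : forall nu : 'I_d, 'I_(n nu) -> R -> R.

(* phi^nu_1, .., phi^nu_(n_nu) are continuous and linearly independent on
   Omega_nu; V_nu is their span.  Values outside Omega_nu are irrelevant. *)
Definition is_basis : Prop :=
  forall nu,
    (forall j : 'I_(n nu), {within Omega nu, continuous (phi j)}) /\
    (forall a : 'I_(n nu) -> R,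
      (forall t, Omega nu t -> \sum_j a j * phi j t = 0) ->
      forall j, a j = 0).

Definition Phi1 (nu : 'I_d) (t : R) : 'cV[R]_(n nu) := \col_j phi j t.

Definition Phi (x : borel_domain x0) : 'cV[R]_#|mindex n| :=
  tens (fun nu => Phi1 nu (coord x nu)).

(* V_1 (x) .. (x) V_d as a space of functions on the domain *)
Definition tensor_space : set (borel_domain x0 -> R) :=
  [set f | exists a : 'rV[R]_#|mindex n|, f = fun x => (a *m Phi x) 0 0].

(* <A, Phi(.)> *)
Definition Gmap n0 (A : tensor R n0 n) : borel_domain x0 -> 'cV[R]_n0 :=
  fun x => A *m Phi x.

(* the integral of Phi_1(x_1) Phi_1(x_1)^T (x) .. (x) Phi_d(x_d) Phi_d(x_d)^T *)
Definition gram (mu : probability (borel_domain x0) R) : 'M[R]_#|mindex n| :=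
  \matrix_(i, j) \int[mu]_x
    tensop (fun nu => Phi1 nu (coord x nu) *m (Phi1 nu (coord x nu))^T) i j.

Lemma GmapE n0 (A : tensor R n0 n) x k :
  Gmap A x k 0 = \sum_j A k j * \prod_nu phi (mi j nu) (coord x nu).
Proof.
rewrite mxE; apply: eq_bigr => j _; rewrite !mxE; congr (_ * _).
by apply: eq_bigr => nu _; rewrite mxE.
Qed.

End FunctionSpaces.

(* Square-integrable maps X -> Y, with Y = R^n0.  Maps stand for their classes
   modulo mu-a.e. equality: every notion below is invariant under it. *)
Section L2.
Context {R : realType} {n0 : nat} {disp : measure_display}.
Context {X : measurableType disp} (mu : probability X R).
Variable ipY : 'cV[R]_n0 -> 'cV[R]_n0 -> R.

Definition L2 : set (X -> 'cV[R]_n0) :=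
  [set f | forall k, (fun x => f x k 0) \in Lfun mu 2%:E].

Definition L2dot (f g : X -> 'cV[R]_n0) : R := \int[mu]_x ipY (f x) (g x).

Definition L2norm (f : X -> 'cV[R]_n0) : R := Num.sqrt (L2dot f f).

Definition L2curve_in (H : set (X -> 'cV[R]_n0)) (f zeta : X -> 'cV[R]_n0)
    (c : R -> X -> 'cV[R]_n0) : Prop :=
  [/\ c 0 = f, (\forall t \near (0 : R), H (c t)) &
      L2norm (fun x => t^-1 *: (c t x - f x) - zeta x) @[t --> (0 : R)^'] --> (0 : R)].

Definition L2tangent_space (H : set (X -> 'cV[R]_n0)) (f : X -> 'cV[R]_n0) :
    set (X -> 'cV[R]_n0) :=
  [set zeta | L2 zeta /\ exists c, L2curve_in H f zeta c].

End L2.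

Section Differential.
Context {R : realType} {n0 N : nat} {disp : measure_display}.
Context {X : measurableType disp} (mu : probability X R).
Variable ipY : 'cV[R]_n0 -> 'cV[R]_n0 -> R.
Variables (T : set 'M[R]_(n0, N)) (G : 'M[R]_(n0, N) -> X -> 'cV[R]_n0).
Variable A : 'M[R]_(n0, N).

Let H := G @` T.

(* DG : T_A T -> T_(G A) H maps the velocity at A of a curve of T to the
   velocity at G A of its image under G. *)
Definition is_differential (DG : 'M[R]_(n0, N) -> X -> 'cV[R]_n0) : Prop :=
  forall xi, tangent_space T A xi ->
    L2tangent_space mu ipY H (G A) (DG xi) /\
    forall c, curve_in T A xi c ->
      L2curve_in mu ipY H (G A) (DG xi) (G \o c).

(* DGs : T_(G A) H -> T_A T is the adjoint of DG for the metric ipT on T and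
   the L2 metric on H. *)
Definition is_adjoint (ipT : 'M[R]_(n0, N) -> 'M[R]_(n0, N) -> R)
    (DG : 'M[R]_(n0, N) -> X -> 'cV[R]_n0)
    (DGs : (X -> 'cV[R]_n0) -> 'M[R]_(n0, N)) : Prop :=
  forall zeta, L2tangent_space mu ipY H (G A) zeta ->
    tangent_space T A (DGs zeta) /\
    forall xi, tangent_space T A xi ->
      ipT (DGs zeta) xi = L2dot mu ipY zeta (DG xi).

End Differential.

(* Main.v *)
Require Import Defs.
From HB Require Import structures.
From mathcomp Require Import all_boot all_order all_algebra.
From mathcomp Require Import all_classical all_reals all_analysis.
From mathcomp Require Import ring lra.

Set Implicit Arguments.
Unset Strict Implicit.
Unset Printing Implicit Defensive.

Import Order.TTheory GRing.Theory Num.Theory.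
Import numFieldNormedType.Exports.

Local Open Scope classical_set_scope.
Local Open Scope ring_scope.

(** The map G is the restriction to T of a linear map, so its differential at A
    must be xi |-> G xi, and the asserted identity only expresses the bilinear
    form (xi, eta) |-> <G xi, G eta>_L2 through the metric of T.  Expanding
    G xi = \sum_i Phi_i (col i xi) and integrating gives
      <G xi, G eta>_L2
        = \sum_(i, j) ipY (col i xi) (col j eta) * \int Phi_i Phi_j
        = ipT ((I (x) K) xi) eta,
    K being the Gram matrix of the entries of Phi (L2dot_Gmap); K is the
    integral of the tensor products Phi_nu Phi_nu^T because the entries of a
    tensor product of rank-one matrices are products of products (gramE).
    Since DG^* DG xi is tangent and satisfies
    ipT (DG^* DG xi) eta = <DG xi, DG eta>_L2 for all tangent eta, it is the
    orthogonal projection of (I (x) K) xi.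

    Two points need care.  A differential is determined only up to
    mu-negligible sets, being an L2-limit of difference quotients; two such
    limits have the same inner product with every element of L2
    (L2_limit_unique), so an arbitrary DG may be replaced by G inside L2
    products (L2dot_differential).  The existence of the adjoint is the Riesz
    representation theorem on T_A T, which requires the set of velocities of
    curves through A to be a finite-dimensional linear space; a slice chart
    (h, g) at A identifies it with the image under the differential of g of
    the coordinate plane of the first m coordinates (tangent_space_span). *)

(** * Inner products on matrix spaces *)

Lemma dotC (R : realFieldType) (V : lmodType R) (ip : {dot V for idfun}) u v :
  ip u v = ip v u.
Proof. by rewrite hermC mul1r. Qed.

Lemma dot_ge0 (R : realFieldType) (V : lmodType R) (ip : {dot V for idfun}) u :
  0 <= ip u u.
Proof. by have [->|/neq0_dnorm_gt0/ltW//] := eqVneq u 0; rewrite linear0l. Qed.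

Lemma sum_delta_col (R : pzRingType) n (u : 'cV[R]_n) :
  u = \sum_k u k 0 *: delta_mx k 0.
Proof. by rewrite {1}[u]matrix_sum_delta; apply: eq_bigr => k _; rewrite big_ord1. Qed.

Lemma mulmx_sum_col (R : comPzRingType) p q (M : 'M[R]_(p, q)) (v : 'cV[R]_q) :
  M *m v = \sum_j v j 0 *: col j M.
Proof.
apply/colP => i; rewrite summxE mxE.
by apply: eq_bigr => j _; rewrite !mxE mulrC.
Qed.

Lemma dot_cV (R : realFieldType) n (ip : {dot 'cV[R]_n for idfun}) u v :
  ip u v = \sum_k \sum_l ip (delta_mx k 0) (delta_mx l 0) * (u k 0 * v l 0).
Proof.
rewrite {1}[u]sum_delta_col linear_sumlz; apply: eq_bigr => k _.
rewrite linearZl_LR /= {1}[v]sum_delta_col linear_sumr mulr_sumr.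
by apply: eq_bigr => l _; rewrite linearZr_LR /=; ring.
Qed.

(** Riesz representation on the span of a finite family, which need not be
    free.  The coefficients w solve w *m M = b, with M the Gram matrix of the
    family; this is solvable because a kernel vector v of M satisfies
    ip x x = 0 for x = \sum_j v j *: e j, so that x = 0 and b kills v. *)
Lemma riesz_on_span (R : realFieldType) (V : lmodType R)
    (ip : {dot V for idfun}) k (e : 'I_k -> V) (l : {scalar V}) :
  exists w : 'I_k -> R, forall v : 'I_k -> R,
    ip (\sum_i w i *: e i) (\sum_j v j *: e j) = l (\sum_j v j *: e j).
Proof.
pose M := \matrix_(i, j) ip (e i) (e j).
pose b := \row_j l (e j).
have : (b <= M)%MS.
  rewrite submxE; apply/eqP/rowP => c; rewrite !mxE.
  pose v j := cokermx M j c.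
  pose x := \sum_j v j *: e j.
  suff x0 : x = 0.
    transitivity (l x); last by rewrite x0 linear0.
    by rewrite linear_sum; apply: eq_bigr => j _; rewrite linearZ mxE mulrC.
  apply: contraPeq (mulmx_coker M) => x_neq0 Mv0.
  suff : ip x x = 0 by move/eqP; rewrite gt_eqF ?neq0_dnorm_gt0.
  have Mv0i i : ip (e i) x = 0.
    have /matrixP/(_ i c) := Mv0; rewrite !mxE => <-.
    rewrite linear_sumr; apply: eq_bigr => j _.
    by rewrite linearZr_LR /= [M i j]mxE mulrC.
  by rewrite {1}/x linear_sumlz big1 // => i _; rewrite linearZl_LR /= Mv0i mulr0.
move=> /submxP[D bD]; exists (D 0) => v.
rewrite linear_sumr linear_sum; apply: eq_bigr => j _.
rewrite linearZr_LR linearZ /=; congr (_ * _).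
have /rowP/(_ j) := bD; rewrite !mxE => ->.
by rewrite linear_sumlz; apply: eq_bigr => i _; rewrite linearZl_LR mxE.
Qed.

(** The metric of the tensor space is packaged as a dot product, so that the
    Riesz representation applies to it. *)
Section TensorDot.
Variables (R : realType) (n0 d : nat) (n : 'I_d -> nat).
Variable ipY : {dot 'cV[R]_n0 for idfun}.
Local Notation ipT := (tensor_dot ipY (n := n)).

Lemma tensor_dotC A B : ipT A B = ipT B A.
Proof. by apply: eq_bigr => j _; rewrite dotC. Qed.

Lemma tensor_dot_linear C : linear_for *%R (ipT^~ C).
Proof.
move=> a A B; rewrite /tensor_dot mulr_sumr -big_split; apply: eq_bigr => j _.
by rewrite linearP linearPl.
Qed.

Lemma tensor_dot_gt0 A : A != 0 -> 0 < ipT A A.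
Proof.
move=> A0; have ge0 : 0 <= ipT A A by apply: sumr_ge0 => j _; exact: dot_ge0.
rewrite lt0r ge0 andbT; apply: contra A0 => /eqP s0.
apply/eqP/matrixP => i j; rewrite mxE.
have /eqP : ipY (col j A) (col j A) = 0.
  by apply: (psumr_eq0P _ s0) => // j' _; exact: dot_ge0.
apply: contraTeq => Aij; rewrite gt_eqF// neq0_dnorm_gt0//.
by apply: contra Aij => /eqP/colP/(_ i); rewrite !mxE => ->.
Qed.

Lemma tensor_dot_bilinear : bilinear_for *%R *%R ipT.
Proof.
split=> [C|C a A B]; first exact: tensor_dot_linear.
by rewrite !(tensor_dotC C) tensor_dot_linear.
Qed.

HB.instance Definition _ := bilinear_isBilinear.Build R _ _ _
  (GRing.Scale.Law.clone _ _ ( *%R) _)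
  (GRing.Scale.Law.clone _ _ (idfun \; *%R) _) ipT tensor_dot_bilinear.

Lemma tensor_dot_hermitian A B : ipT A B = (-1) ^+ false * idfun (ipT B A).
Proof. by rewrite mul1r tensor_dotC. Qed.

HB.instance Definition _ :=
  isHermitianSesquilinear.Build R _ _ _ ipT tensor_dot_hermitian.
HB.instance Definition _ := isDotProduct.Build R _ ipT tensor_dot_gt0.

End TensorDot.

(** * Tangent spaces of embedded submanifolds *)

Section TangentSpace.
Context {R : realType}.

(** Taking the point a apart from c t avoids rewriting inside the type of the
    differential. *)
Lemma is_derive_comp (E F : normedModType R) (c : R -> E) (f : E -> F) t a xi :
  c t = a -> is_derive t (1 : R) c xi -> differentiable f a ->
  is_derive t (1 : R) (f \o c) ('d f a xi).
Proof.
move=> <- [/derivable1_diffP dc <-] df.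
have dfc : differentiable (f \o c) t by exact: differentiable_comp.
apply: DeriveDef; first exact: diff_derivable.
by rewrite (deriveE _ dfc) (deriveE _ dc) diff_comp.
Qed.

Lemma is_derive_coord p q (c : R -> 'M[R]_(p, q)) t xi i j :
  is_derive t (1 : R) c xi -> is_derive t (1 : R) (fun s => c s i j) (xi i j).
Proof.
have coordP : scalar (fun N : 'M[R]_(p, q) => N i j : R^o).
  by move=> a M N; rewrite !mxE.
pose f : {linear 'M[R]_(p, q) -> R^o} :=
  HB.pack (fun N : 'M[R]_(p, q) => N i j) (GRing.isLinear.Build _ _ _ _ _ coordP).
have fc : continuous f by exact: coord_continuous.
move=> dc; have := is_derive_comp erefl dc (linear_differentiable (c t) fc).
by rewrite (diff_lin _ fc).
Qed.

Lemma is_derive_line (E : normedModType R) (a v : E) :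
  is_derive (0 : R) (1 : R) (fun t : R => a + t *: v) v.
Proof.
have cv : h^-1 *: ((fun t : R => a + t *: v) (h *: 1 + 0) - (a + 0 *: v))
    @[h --> (0 : R)^'] --> v.
  apply: cvg_near_cst; near=> h.
  have h0 : h != 0 by near: h; exact: nbhs_dnbhs_neq.
  by rewrite /= [h *: 1]mulr1 addr0 scale0r addr0 addrAC subrr add0r scalerA mulVf ?scale1r.
apply: DeriveDef; first by apply/cvg_ex; exists v.
exact: cvg_lim cv.
Unshelve. all: by end_near. Qed.

(** Velocities of curves form a linear space: in a slice chart h with inverse
    g, a curve c in S is g \o (h \o c) with h \o c in the plane of the first m
    coordinates, so its velocity is the image under 'd g (h A) of a vector of
    that plane; conversely t |-> g (h A + t *: y) is a curve in S for each y
    in the plane.  The family e is the image of the canonical basis, with the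
    vectors outside the plane replaced by 0. *)
Lemma tangent_space_span p q m (S : set 'M[R]_(p, q)) A :
  embedded_submanifold m S -> S A ->
  exists e : 'I_(p * q) -> 'M[R]_(p, q),
    forall xi, tangent_space S A xi <-> exists w, xi = \sum_i w i *: e i.
Proof.
move=> [_ /(_ A)] slice SA.
have {slice} [U [W [h [g [[oU UA oW sh sg] [hg gh slice]]]]]] := slice SA.
have [WhA ghA] := hg A UA.
have dh : differentiable h A := (sh 1%N).1 A UA.
have dg : differentiable g (h A) := (sg 1%N).1 _ WhA.
pose e (i : 'I_(p * q)) := if (i < m)%N then 'd g (h A) (delta_mx 0 i) else 0.
have dgE (y : 'rV[R]_(p * q)) : (forall i : 'I__, (m <= i)%N -> y 0 i = 0) ->
    'd g (h A) y = \sum_i y 0 i *: e i.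
  move=> y0; rewrite {1}[y]row_sum_delta linear_sum; apply: eq_bigr => i _.
  rewrite linearZ /= /e; case: ltnP => // /y0 ->.
  by rewrite !scale0r.
exists e => xi; split=> [[c [c0 Sc dc]]|[w ->]].
  have dhc : is_derive (0 : R) (1 : R) (h \o c) ('d h A xi).
    exact: is_derive_comp c0 dc dh.
  have Uc : \forall t \near (0 : R), U (c t).
    have cc : {for 0, continuous c}.
      by apply/differentiable_continuous/derivable1_diffP; exact: ex_derive.
    by apply: cc; rewrite c0; exact: open_nbhs_nbhs.
  exists (fun i => 'd h A xi 0 i); rewrite -dgE.
    have dghc : is_derive (0 : R) (1 : R) (g \o (h \o c)) ('d g (h A) ('d h A xi)).
      by apply: is_derive_comp dhc dg; rewrite /= c0.
    rewrite -[LHS](@derive_val _ _ _ _ _ _ _ dc) -[RHS](@derive_val _ _ _ _ _ _ _ dghc).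
    by apply: near_eq_derive; apply: filterS Uc => t /hg[_ /= ->].
  move=> i mi; have /(@is_derive_coord _ _ _ _ _ 0 i) dhci := dhc.
  rewrite -[LHS](@derive_val _ _ _ _ _ _ _ dhci) -[RHS](derive_cst (0 : R^o) (0 : R^o) 1).
  apply: near_eq_derive; near=> t => /=.
  have /slice/iffLR : U (c t) by near: t.
  by apply => //; near: t.
pose y : 'rV[R]_(p * q) := \row_i (if (i < m)%N then w i else 0).
have y0 (i : 'I__) : (m <= i)%N -> y 0 i = 0 by rewrite mxE ltnNge => ->.
have -> : \sum_i w i *: e i = 'd g (h A) y.
  rewrite dgE //; apply: eq_bigr => i _; rewrite mxE /e.
  by case: ifP => //; rewrite !scaler0.
have hA0 (i : 'I__) : (m <= i)%N -> h A 0 i = 0 by move: i; apply/slice.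
have dl := is_derive_line (h A) y.
pose l t := h A + t *: y.
exists (g \o l); split.
- by rewrite /l /= scale0r addr0.
- have Wl : \forall t \near (0 : R), W (l t).
    have cl : {for 0, continuous l}.
      by apply/differentiable_continuous/derivable1_diffP; exact: ex_derive.
    by apply: cl; rewrite /l scale0r addr0; exact: open_nbhs_nbhs.
  apply: filterS Wl => t /gh[Ug hgl].
  by apply/slice => // i mi; rewrite hgl !mxE hA0 // ltnNge mi mulr0 addr0.
- by apply: is_derive_comp dl dg; rewrite scale0r addr0.
Unshelve. all: by end_near. Qed.

Lemma curve_in_cvg p q (S : set 'M[R]_(p, q)) A xi c :
  curve_in S A xi c ->
  t^-1 *: (c t - A) - xi @[t --> (0 : R)^'] --> (0 : 'M[R]_(p, q)).
Proof.
move=> [c0 _ [dc <-]]; rewrite -(subrr ('D_1 c 0)).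
apply: cvgB; last exact: cvg_cst.
apply: cvg_trans dc; apply: near_eq_cvg; near=> t.
by rewrite /= c0 [t *: 1]mulr1 addr0.
Unshelve. all: by end_near. Qed.

End TangentSpace.

(** * The inner product of L2 *)

Section SquareIntegrable.
Context {R : realType} {disp : measure_display} {X : measurableType disp}.
Variable mu : probability X R.

Lemma Lfun2_mul_integrable (f g : X -> R) :
  f \in Lfun mu 2%:E -> g \in Lfun mu 2%:E ->
  mu.-integrable setT (EFin \o (fun x => f x * g x)).
Proof. by move=> f2 g2; apply/Lfun1_integrable/Lfun2_mul_Lfun1. Qed.

Lemma integrable_Zl a (f : X -> R) :
  mu.-integrable setT (EFin \o f) ->
  mu.-integrable setT (EFin \o (fun x => a * f x)).
Proof. exact: integrableZl. Qed.

Lemma integrable_Rsum I (s : seq I) (f : I -> X -> R) :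
  (forall i, mu.-integrable setT (EFin \o f i)) ->
  mu.-integrable setT (EFin \o (fun x => \sum_(i <- s) f i x)).
Proof.
move=> fi; rewrite (_ : _ \o _ = fun x => (\sum_(i <- s) (f i x)%:E)%E).
  by apply: integrable_sum => // i _; exact: fi.
by apply/funext => x; rewrite /= sumEFin.
Qed.

Lemma Rintegral_sum I (s : seq I) (f : I -> X -> R) :
  (forall i, mu.-integrable setT (EFin \o f i)) ->
  \int[mu]_x (\sum_(i <- s) f i x) = \sum_(i <- s) \int[mu]_x f i x.
Proof.
move=> fi; elim: s => [|i s IH].
  by under eq_Rintegral do rewrite big_nil; rewrite big_nil Rintegral_cst // mul0r.
rewrite big_cons -IH -RintegralD //; last exact: integrable_Rsum.
by apply: eq_Rintegral => x _; rewrite big_cons.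
Qed.

Context {n0 : nat}.
Variable ipY : {dot 'cV[R]_n0 for idfun}.
Local Notation L2 := (L2 (n0 := n0) mu).
Local Notation L2dot := (L2dot mu ipY).
Local Notation L2norm := (L2norm mu ipY).
Implicit Types (f g h : X -> 'cV[R]_n0).

Lemma L2_linear a f g : L2 f -> L2 g -> L2 (a *: f + g).
Proof.
move=> f2 g2 k.
rewrite (_ : (fun x => _) = a *: (fun x => f x k 0) + (fun x => g x k 0)).
  exact: (Lfun_submod_closed mu (lee1n 2)).2.
by apply/funext => x; rewrite !mxE.
Qed.

Lemma L2_ip_integrable f g :
  L2 f -> L2 g -> mu.-integrable setT (EFin \o (fun x => ipY (f x) (g x))).
Proof.
move=> f2 g2.
under [X in EFin \o X]eq_fun do rewrite dot_cV.
do 2![apply: integrable_Rsum => ?].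
exact/integrable_Zl/Lfun2_mul_integrable.
Qed.

Lemma L2dotC f g : L2dot f g = L2dot g f.
Proof. by apply: eq_Rintegral => x _; rewrite dotC. Qed.

Lemma L2dot_linear a f g h : L2 f -> L2 g -> L2 h ->
  L2dot (a *: f + g) h = a * L2dot f h + L2dot g h.
Proof.
move=> f2 g2 h2; rewrite /L2dot -RintegralZl //; last exact: L2_ip_integrable.
rewrite -RintegralD //; try exact: L2_ip_integrable.
  by apply: eq_Rintegral => x _; rewrite linearPl.
exact/integrable_Zl/L2_ip_integrable.
Qed.

Lemma L2dot_ge0 f : 0 <= L2dot f f.
Proof. by apply: Rintegral_ge0 => x _; exact: dot_ge0. Qed.

Lemma L2dot_sqr_linear a f g : L2 f -> L2 g ->
  L2dot (a *: f + g) (a *: f + g) =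
  a ^+ 2 * L2dot f f + 2 * a * L2dot f g + L2dot g g.
Proof.
move=> f2 g2; have fg2 := L2_linear a f2 g2.
rewrite L2dot_linear // !(L2dotC _ (_ + _)) !L2dot_linear //.
by rewrite (L2dotC g f); ring.
Qed.

(** L2dot is only semidefinite on functions, and its null vectors are orthogonal
    to all of L2: otherwise L2dot (a *: f + g) (a *: f + g), which is affine in
    a, would take negative values. *)
Lemma L2dot_null f g : L2 f -> L2 g -> L2dot f f = 0 -> L2dot f g = 0.
Proof.
move=> f2 g2 f0; apply/eqP; apply: contraT => fg0.
(* the value of a at which the affine function equals -1 *)
pose a := - (L2dot g g + 1) / (2 * L2dot f g).
have := L2dot_ge0 (a *: f + g); rewrite L2dot_sqr_linear // f0 mulr0 add0r.
suff -> : 2 * a * L2dot f g = - (L2dot g g + 1) by lra.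
by rewrite /a; field.
Qed.

Lemma L2dot_sub_le f g : L2 f -> L2 g ->
  L2dot (f - g) (f - g) <= 2 * (L2norm f ^+ 2 + L2norm g ^+ 2).
Proof.
move=> f2 g2; rewrite !sqr_sqrtr ?L2dot_ge0 //.
have := L2dot_ge0 (1 *: f + g).
have -> : f - g = -1 *: g + f by rewrite scaleN1r addrC.
rewrite !L2dot_sqr_linear //.
by rewrite (L2dotC g f); lra.
Qed.

(** Limits in L2 are unique modulo null vectors: g - f has norm 0 by
    L2dot_sub_le, since f and g are both close to q t. *)
Lemma L2_limit_unique (q : R -> X -> 'cV[R]_n0) (f g h : X -> 'cV[R]_n0) :
  (forall t, L2 (q t)) -> L2 f -> L2 g -> L2 h ->
  L2norm (q t - f) @[t --> (0 : R)^'] --> (0 : R) ->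
  L2norm (q t - g) @[t --> (0 : R)^'] --> (0 : R) ->
  L2dot f h = L2dot g h.
Proof.
move=> q2 f2 g2 h2 qf qg.
have L2B u v : L2 u -> L2 v -> L2 (u - v).
  by move=> u2 v2; rewrite addrC -scaleN1r; exact: L2_linear.
have fg0 : L2dot (g - f) (g - f) = 0.
  apply/eqP; rewrite eq_le L2dot_ge0 andbT.
  have lim0 : 2 * (L2norm (q t - f) ^+ 2 + L2norm (q t - g) ^+ 2) @[t --> (0:R)^'] --> (0 : R).
    rewrite [X in _ --> X](_ : 0 = 2 * (0 * 0 + 0 * 0)); last by ring.
    by apply: cvgM; [exact: cvg_cst|apply: cvgD; apply: cvgM].
  apply: (cvgr_to_ge lim0); near=> t.
  rewrite (_ : g - f = (q t - f) - (q t - g)); last by rewrite opprB [RHS]addrC subrKA.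
  by apply: L2dot_sub_le; exact: L2B.
have := L2dot_null (L2B _ _ g2 f2) h2 fg0.
rewrite addrC -scaleN1r L2dot_linear // mulN1r => /eqP.
by rewrite addrC subr_eq0 eq_sym => /eqP.
Unshelve. all: by end_near. Qed.

End SquareIntegrable.

(** * The parametrization by tensors *)

Lemma cvg_Rsum (R : realType) (X : Type) (F : set_system X) {FF : Filter F} k
    (f : 'I_k -> X -> R) (l : 'I_k -> R) :
  (forall i, f i x @[x --> F] --> l i) ->
  \sum_i f i x @[x --> F] --> \sum_i l i.
Proof. by move=> fl; apply: cvg_big => // *; exact: add_continuous. Qed.

Section Model.
Variables (R : realType) (d n0 : nat) (n : 'I_d -> nat).
Variables (Omega : 'I_d -> set R) (x0 : domain_set Omega).
Variable mu : probability (borel_domain x0) R.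
Variable phi : forall nu : 'I_d, 'I_(n nu) -> R -> R.
Hypothesis V_L2 : forall f, tensor_space (x0 := x0) phi f -> f \in Lfun mu 2%:E.
Variable ipY : {dot 'cV[R]_n0 for idfun}.

Local Notation Phi := (Phi (x0 := x0) phi).
Local Notation G := (Gmap (x0 := x0) phi (n0 := n0)).
Local Notation ipT := (tensor_dot ipY (n := n)).
Local Notation K := (gram phi mu).
Local Notation L2 := (L2 (n0 := n0) mu).
Local Notation L2dot := (L2dot mu ipY).
Local Notation L2norm := (L2norm mu ipY).
Local Notation tensor := (tensor R n0 n).
Implicit Types A B C xi : tensor.

Lemma Phi_L2 j : (fun x => Phi x j 0) \in Lfun mu 2%:E.
Proof. by apply: V_L2; exists (delta_mx 0 j); apply/funext => x; rewrite -rowE [RHS]mxE. Qed.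

Lemma gramE i j : K i j = \int[mu]_x (Phi x i 0 * Phi x j 0).
Proof.
rewrite mxE; apply: eq_Rintegral => x _; rewrite !mxE -big_split.
by apply: eq_bigr => nu _; rewrite mxE big_ord1 !mxE.
Qed.

Lemma Gmap_linear : linear G.
Proof. by move=> a B C; apply/funext => x; rewrite /Gmap mulmxDl -scalemxAl. Qed.

Lemma Gmap_L2 B : L2 (G B).
Proof.
by move=> k; apply: V_L2; exists (row k B); apply/funext => x; rewrite -row_mul [RHS]mxE.
Qed.

(** The pullback of the L2 metric under G is represented by I (x) K. *)
Lemma L2dot_Gmap B C : L2dot (G B) (G C) = ipT (tensop0 1%:M K B) C.
Proof.
have PhiI i j : mu.-integrable setT (EFin \o (fun x => Phi x i 0 * Phi x j 0)).
  exact: Lfun2_mul_integrable (Phi_L2 i) (Phi_L2 j).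
transitivity (\int[mu]_x \sum_j \sum_i
    ipY (col i B) (col j C) * (Phi x j 0 * Phi x i 0)).
  apply: eq_Rintegral => x _; rewrite /Gmap (mulmx_sum_col C) linear_sumr.
  apply: eq_bigr => j _; rewrite linearZr_LR /= mulmx_sum_col linear_sumlz mulr_sumr.
  by apply: eq_bigr => i _; rewrite linearZl_LR /=; ring.
rewrite Rintegral_sum => [|j]; last first.
  by apply: integrable_Rsum => i; exact/integrable_Zl/PhiI.
apply: eq_bigr => j _; rewrite Rintegral_sum => [|i]; last exact/integrable_Zl/PhiI.
have -> : col j (tensop0 1%:M K B) = \sum_i K j i *: col i B.
  rewrite /tensop0 mul1mx colE -mulmxA mulmx_sum_col.
  by apply: eq_bigr => i _; rewrite -colE [in LHS]mxE [in LHS]mxE.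
rewrite linear_sumlz; apply: eq_bigr => i _.
by rewrite linearZl_LR /= gramE RintegralZl // mulrC.
Qed.

Lemma L2dot_Gmap_scalar zeta : L2 zeta -> scalar (fun xi => L2dot zeta (G xi)).
Proof.
move=> zeta2 a B C; rewrite Gmap_linear !(L2dotC _ _ zeta).
exact: L2dot_linear (Gmap_L2 B) (Gmap_L2 C) zeta2.
Qed.

(** Continuity at 0 of the quadratic form B |-> ipT (tensop0 1 K B) B, which is
    a polynomial in the entries of B. *)
Lemma L2norm_Gmap_cvg0 (X : Type) (F : set_system X) {FF : Filter F} (B : X -> tensor) :
  B x @[x --> F] --> (0 : tensor) -> L2norm (G (B x)) @[x --> F] --> (0 : R).
Proof.
move=> B0; rewrite -[X in _ --> X](sqrtr0 R).
apply: continuous_cvg; first exact: sqrt_continuous.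
under eq_fun do rewrite L2dot_Gmap.
have Bij i j : B x i j @[x --> F] --> (0 : tensor) i j.
  exact: cvg_comp B0 (@coord_continuous _ _ _ i j (0 : tensor)).
have BKij i j : (B x *m K^T) i j @[x --> F] --> ((0 : tensor) *m K^T) i j.
  under eq_fun do rewrite mxE; rewrite mxE.
  by apply: cvg_Rsum => k; apply: cvgM; [exact: Bij|exact: cvg_cst].
have colij p (M : 'M[R]_(n0, p)) j k : col j M k 0 = M k j by rewrite mxE.
have -> : 0 = ipT (tensop0 1%:M K 0) 0 by rewrite linear0r.
apply: cvg_Rsum => j; under eq_fun do rewrite dot_cV.
rewrite dot_cV; apply: cvg_Rsum => k; apply: cvg_Rsum => l.
apply: cvgM; first exact: cvg_cst.
under eq_fun do rewrite /tensop0 mul1mx !colij.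
rewrite /tensop0 mul1mx !colij.
by apply: cvgM; [exact: BKij|exact: Bij].
Qed.

(** The error of the difference quotient of G \o c is the image under G of the
    error of the difference quotient of c. *)
Lemma Gmap_curve T A xi c : curve_in T A xi c ->
  L2curve_in mu ipY (G @` T) (G A) (G xi) (G \o c).
Proof.
move=> cxi; have [c0 Tc _] := cxi; split.
- by rewrite /= c0.
- by near=> t; exists (c t) => //; near: t.
- apply: cvg_trans (L2norm_Gmap_cvg0 (curve_in_cvg cxi)).
  apply: near_eq_cvg; near=> t; congr L2norm; apply/funext => x.
  by rewrite /Gmap mulmxBl -scalemxAl mulmxBl.
Unshelve. all: by end_near. Qed.

Lemma is_differential_Gmap T A : is_differential mu ipY T G A G.
Proof.
move=> xi [c cxi]; split; last by move=> c'; exact: Gmap_curve.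
by split; [exact: Gmap_L2|exists (G \o c); exact: Gmap_curve].
Qed.

(** DG xi and G xi are limits of the same difference quotients. *)
Lemma L2dot_differential T A DG : is_differential mu ipY T G A DG ->
  forall xi h, tangent_space T A xi -> L2 h ->
  L2dot (DG xi) h = L2dot (G xi) h.
Proof.
move=> dG xi h Txi h2; have [[DG2 _] DGc] := dG xi Txi.
have [c cxi] := Txi.
have [_ _ limDG] := DGc c cxi.
have [_ _ limG] := Gmap_curve cxi.
pose q t : borel_domain x0 -> 'cV[R]_n0 := G (t^-1 *: (c t - A)).
have qE t x : t^-1 *: (G (c t) x - G A x) = q t x.
  by rewrite /q /Gmap -scalemxAl mulmxBl.
have q2 t : L2 (q t) by exact: Gmap_L2.
apply: (L2_limit_unique q2 DG2 (Gmap_L2 xi) h2).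
- apply: cvg_trans limDG; apply: near_eq_cvg; near=> t; congr L2norm.
  by apply/funext => x /=; rewrite qE.
- apply: cvg_trans limG; apply: near_eq_cvg; near=> t; congr L2norm.
  by apply/funext => x /=; rewrite qE.
Unshelve. all: by end_near. Qed.

End Model.

Theorem proposition3p5 (R : realType) (d n0 : nat) (n : 'I_d -> nat)
    (Omega : 'I_d -> set R) (x0 : domain_set Omega)
    (mu : probability (borel_domain x0) R)
    (phi : forall nu : 'I_d, 'I_(n nu) -> R -> R)
    (phi_basis : is_basis (Omega := Omega) phi)
    (V_L2 : forall f, tensor_space (x0 := x0) phi f -> f \in Lfun mu 2%:E)
    (ipY : {dot 'cV[R]_n0 for idfun})
    (m : nat) (T : set (tensor R n0 n)) (T_mfd : embedded_submanifold m T)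
    (A : tensor R n0 n) (TA : T A) :
  let G := Gmap (x0 := x0) phi (n0 := n0) in
  let ipT := tensor_dot ipY (n := n) in
  (exists DG DGs,
     is_differential mu ipY T G A DG /\ is_adjoint mu ipY T G A ipT DG DGs) /\
  (forall DG DGs,
     is_differential mu ipY T G A DG -> is_adjoint mu ipY T G A ipT DG DGs ->
     forall xi, tangent_space T A xi ->
       is_orth_proj ipT (tangent_space T A)
         (tensop0 1%:M (gram phi mu) xi) (DGs (DG xi))).
Proof.
move=> G ipT; split.
  have [e TE] := tangent_space_span T_mfd TA.
  (* off the tangent space of H the adjoint takes the default value 0 *)
  have adj zeta : exists B, L2tangent_space mu ipY (G @` T) (G A) zeta ->
      tangent_space T A B /\
      forall xi, tangent_space T A xi -> ipT B xi = L2dot mu ipY zeta (G xi).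
    have [[zeta2 _]|nz] := pselect (L2tangent_space mu ipY (G @` T) (G A) zeta); last by exists 0.
    pose l : {scalar tensor R n0 n} :=
      HB.pack (fun xi => L2dot mu ipY zeta (G xi))
        (GRing.isLinear.Build _ _ _ _ _ (L2dot_Gmap_scalar V_L2 ipY zeta2)).
    have [w wE] := riesz_on_span ipT e l.
    exists (\sum_i w i *: e i) => _; split; first by apply/TE; exists w.
    by move=> _ /TE[v ->]; exact: wE.
  have [DGs DGsP] := choice adj.
  by exists G, DGs; split; [exact: is_differential_Gmap|exact: DGsP].
move=> DG DGs dG adj xi Txi.
have [DGxi2 _] := (dG xi Txi).1.
have [TDGs DGsE] := adj (DG xi) (dG xi Txi).1.
split=> // w Tw.
rewrite DGsE // (L2dot_differential V_L2 dG) //; last exact: (dG w Tw).1.1.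
rewrite L2dotC (L2dot_differential V_L2 dG) //; last exact: Gmap_L2.
by rewrite L2dotC L2dot_Gmap.
Qed.
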